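(* Let $A,B\in\mathbb{M}_d$ be positive semidefinite. Then $$\operatorname{Tr}(A+B)-\operatorname{Tr}(A\vee B)=\operatorname{Tr}(A\wedge B).$$ Consequently, $$\operatorname{Tr}(A\vee B)=\operatorname{Tr}(A+B)\iff A\wedge B=0\iff \operatorname{Ran}A\cap\operatorname{Ran}B=\{0\}.$$
   Context: $\mathbb{M}_d$ is the algebra of complex $d\times d$ matrices and $\operatorname{Tr}$ is the unnormalized trace. For a Hermitian $X\in\mathbb{M}_d$ and $t\in\mathbb{R}$, $E_X(t)=\mathbf{1}_{(t,\infty)}(X)$ is the orthogonal projection onto the span of the eigenvectors of $X$ with eigenvalue $>t$. The spectral order on Hermitian matrices is: $A\preceq B$ iff $E_A(t)\le E_B(t)$ for all $t\in\mathbb{R}$. With this order the Hermitian matrices in $\mathbb{M}_d$ form a lattice (Olson); $A\vee B$ and $A\wedge B$ denote the supremum (join) and infimum (meet). They are characterized by $E_{A\vee B}(t)=E_A(t)\vee E_B(t)$ and $E_{A\wedge B}(t)=E_A(t)\wedge E_B(t)$ for all $t\in\mathbb{R}$, where for orthogonal projections $P,Q$ the projections $P\vee Q$ and $P\wedge Q$ are the orthogonal projections onto $\operatorname{Ran}P+\operatorname{Ran}Q$ and $\operatorname{Ran}P\cap\operatorname{Ran}Q$, respectively. *)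

(* Defs.v *)
From HB Require Import structures.
From mathcomp Require Import all_boot all_order all_algebra.
From mathcomp Require Import complex.
From mathcomp Require Import boolp classical_sets reals.

Set Implicit Arguments.
Unset Strict Implicit.
Unset Printing Implicit Defensive.

Import Order.TTheory GRing.Theory Num.Theory.

Local Open Scope ring_scope.
Local Open Scope complex_scope.
Local Open Scope sesquilinear_scope.
Local Open Scope classical_set_scope.

Section Defs.
Context {R : realType} {d : nat}.
Implicit Types (X A B : 'M[R[i]]_d) (t : R).

(* In R[i], [0 <= z] means that z is real and nonnegative. *)
Definition psdmx A : Prop :=
  A \is hermsymmx /\ forall v : 'cV[R[i]]_d, 0 <= (v ^t* *m A *m v) 0 0.

Definition loewner_le A B : Prop := psdmx (B - A).

(* [spectral_diag X] lists the eigenvalues of a normal matrix X.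
   [eigenspace] and [proj_ortho] use row vectors acted on from the right.  For
   Hermitian X and real a, v *m X = a *: v iff X *m v ^t* = a *: v ^t*, and an
   orthogonal projection is Hermitian, so the matrix below is also the
   orthogonal projection, acting on columns, onto the span of the column
   eigenvectors of X with eigenvalue > t. *)
Definition spectral_proj X t : 'M[R[i]]_d :=
  proj_ortho (\sum_(i < d | (t%:C < spectral_diag X 0 i)%R)
                eigenspace X (spectral_diag X 0 i))%MS.

Definition spectral_le A B : Prop :=
  forall t, loewner_le (spectral_proj A t) (spectral_proj B t).

Definition is_spectral_join A B : set 'M[R[i]]_d :=
  [set J | [/\ J \is hermsymmx, spectral_le A J, spectral_le B J &
     forall K, K \is hermsymmx ->
       spectral_le A K -> spectral_le B K -> spectral_le J K]].

Definition is_spectral_meet A B : set 'M[R[i]]_d :=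
  [set M | [/\ M \is hermsymmx, spectral_le M A, spectral_le M B &
     forall K, K \is hermsymmx ->
       spectral_le K A -> spectral_le K B -> spectral_le K M]].

(* The Hermitian matrices form a lattice for [spectral_le] (Olson), so for
   Hermitian A and B these choose the unique join and meet, and the default
   value 0 of [xget] plays no role. *)
Definition spectral_join A B : 'M[R[i]]_d := xget 0 (is_spectral_join A B).
Definition spectral_meet A B : 'M[R[i]]_d := xget 0 (is_spectral_meet A B).

Definition mxran A : set 'cV[R[i]]_d := range (fun x : 'cV[R[i]]_d => A *m x).

End Defs.

(* Main.v *)
From HB Require Import structures.
Require Import Defs.
From mathcomp Require Import all_boot all_order all_algebra.
From mathcomp Require Import complex.
From mathcomp Require Import boolp classical_sets reals.

(** A Hermitian matrix X is encoded by its spectral subspaces S_X(t), spanned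
    by the eigenvectors with eigenvalue > t, and for orthogonal projections the
    Loewner order is inclusion of ranges.  So the spectral order says that
    S_X(t) is contained in S_Y(t) for every t ([spectral_leP]), and the natural
    candidates for the spectral subspaces of the join and of the meet of A and
    B are S_A(t) + S_B(t) and S_A(t) :&: S_B(t).

    Both candidates really come from Hermitian matrices.  A decreasing family
    of subspaces V(t) that is full for t small, zero for t large, and jumps
    only at the points of a finite set is realised by going up through these
    points: start from a scalar matrix, and at each jump lift the eigenvalue
    of the surviving subspace from its current value, which is the largest
    eigenvalue, to the next threshold.  [raise_top_eigenspace] is one such
    step and [spectral_family] is the result.  It yields a join and a meet;
    any other join or meet has the same spectral subspaces, since the order
    determines them, so [spectral_joinP] and [spectral_meetP] hold for the
    chosen ones.

    The number of eigenvalues > t, counted with multiplicity, is dim S_X(t).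
    By the dimension formula
      dim (S_A + S_B) + dim (S_A :&: S_B) = dim S_A + dim S_B,
    the eigenvalues of the join and the meet put together, and those of A and B
    put together, have equally many members above every t.  Hence they agree as
    multisets, and summing them gives the trace identity ([trace_join_meet]).

    When A and B are positive semidefinite, S_A(t) and S_B(t) are full for
    t < 0, so the meet M has nonnegative eigenvalues.  Then M = 0 iff its trace
    vanishes, which is the first equivalence; and for matrices with nonnegative
    eigenvalues S_X(0) is the row space of X, so the row space of M is the
    intersection of those of A and B, which gives the second one after taking
    adjoints. *)

Set Implicit Arguments.
Unset Strict Implicit.
Unset Printing Implicit Defensive.

Import Order.TTheory GRing.Theory Num.Theory.

Local Open Scope ring_scope.
Local Open Scope complex_scope.
Local Open Scope sesquilinear_scope.
Local Open Scope classical_set_scope.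

(** * Orthogonal projections and the Loewner order *)

Section OrthogonalProjection.
Context {C : numClosedFieldType}.

Lemma hermsymmxP n (X : 'M[C]_n) : reflect (X^t* = X) (X \is hermsymmx).
Proof.
by apply: (iffP (is_hermitianmxP _ _ _)); rewrite expr0 scale1r => /esym.
Qed.

Lemma trmxC_mul m n p (X : 'M[C]_(m, n)) (Y : 'M[C]_(n, p)) :
  (X *m Y)^t* = Y^t* *m X^t*.
Proof. by rewrite trmx_mul map_mxM. Qed.

Lemma dot_ge0 n (v : 'rV[C]_n) : 0 <= (v *m v^t*) 0 0.
Proof. by rewrite -dotmxE dnorm_ge0. Qed.

Lemma dot_eq0 n (v : 'rV[C]_n) : (v *m v^t*) 0 0 = 0 -> v = 0.
Proof. by rewrite -dotmxE => /eqP; rewrite dnorm_eq0 => /eqP. Qed.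

(** The rows of 1 - P are orthogonal to those of P, so P^t* = P *m P^t*, and
    the right-hand side is its own adjoint. *)
Lemma proj_ortho_herm m n (U : 'M[C]_(m, n)) : (proj_ortho U)^t* = proj_ortho U.
Proof.
set P := proj_ortho U.
have PP : P^t* = P *m P^t*.
  have : (1%:M - P) *m P^t* = 0.
    apply/orthomx1P; rewrite -[P in 1%:M - P]mul1mx.
    apply: submx_trans (proj_ortho_compl_sub _ _) _.
    by rewrite submx_ortho proj_orthoE.
  by rewrite mulmxBl mul1mx => /eqP; rewrite subr_eq0 => /eqP.
by clearbody P; rewrite -[RHS]trmxCK PP trmxC_mul trmxCK.
Qed.

Lemma proj_ortho_mul m1 m2 n (U : 'M[C]_(m1, n)) (V : 'M[C]_(m2, n)) :
  (U <= V)%MS -> proj_ortho U *m proj_ortho V = proj_ortho U.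
Proof. by move=> UV; rewrite proj_ortho_id // proj_orthoE. Qed.

End OrthogonalProjection.

(** If P <= Q and u is in U, then u - u Q has square norm u (P - Q) u^t* <= 0,
    so u = u Q lies in V.  Conversely, when U is contained in V the difference
    Q - P is a Hermitian idempotent, hence a Gram matrix. *)
Lemma loewner_proj_ortho (R : realType) d (U V : 'M[R[i]]_d) :
  loewner_le (proj_ortho U) (proj_ortho V) <-> (U <= V)%MS.
Proof.
have := proj_ortho_herm V; have := proj_ortho_herm U.
have := proj_ortho_proj V; have := proj_ortho_proj U.
have PU m (W : 'M_(m, d)) := @proj_ortho_id _ _ _ _ U W.
have subV m (W : 'M_(m, d)) := proj_ortho_sub V W.
have PQ := @proj_ortho_mul _ _ _ _ U V.
move: (proj_ortho U) (proj_ortho V) PU subV PQ => P Q PU subV PQ /= PP QQ Ph Qh.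
have QPh : (Q - P)^t* = Q - P by rewrite linearB /= map_mxB Ph Qh.
split=> [[_ QP]|UV].
  apply/row_subP => k; set u := row k U.
  have uP : u *m P = u by rewrite PU ?row_sub.
  suff <- : u *m Q = u by exact: subV.
  apply/eqP; rewrite -subr_eq0 -oppr_eq0 opprB; apply/eqP/dot_eq0.
  have uQ : (u - u *m Q) *m (u - u *m Q)^t* = u *m (P - Q) *m u^t*.
    rewrite linearB /= map_mxB trmxC_mul Qh mulmxBr mulmxA.
    rewrite [(_ - _) *m Q]mulmxBl -[u *m Q *m Q]mulmxA QQ.
    by rewrite subrr mul0mx subr0 mulmxBr uP.
  apply/eqP; rewrite eq_le dot_ge0 andbT uQ -(opprB Q) mulmxN mulNmx mxE.
  by rewrite oppr_le0 -[u in u *m (_ - _)]trmxCK; exact: QP.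
split; first exact/hermsymmxP.
move=> v; have {}PQ := PQ UV.
have QP : Q *m P = P by rewrite -[LHS]trmxCK trmxC_mul Ph Qh PQ Ph.
have idem : (Q - P) *m (Q - P) = Q - P.
  by rewrite mulmxBr !mulmxBl PP QQ PQ QP subrr subr0.
rewrite -idem mulmxA -mulmxA -{2}QPh -{2}[v]trmxCK -trmxC_mul.
exact: dot_ge0.
Qed.

(** * Spectral subspaces *)

(** Locked because a failing unification between the spectral subspaces of two
    matrices would otherwise unfold down to the elimination algorithm that
    computes eigenspaces. *)
HB.lock Definition spectral_space (R : realType) d (X : 'M[R[i]]_d) (t : R) :
    'M[R[i]]_d :=
  (\sum_(i < d | (t%:C < spectral_diag X 0 i)%R)
     eigenspace X (spectral_diag X 0 i))%MS.

Section SpectralSubspace.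
Context {R : realType} {d : nat}.
Implicit Types (X : 'M[R[i]]_d) (t : R) (a : R[i]).

Lemma spectral_projE X t : spectral_proj X t = proj_ortho (spectral_space X t).
Proof. by rewrite spectral_space.unlock. Qed.

Lemma spectral_leP X Y :
  spectral_le X Y <-> forall t, (spectral_space X t <= spectral_space Y t)%MS.
Proof.
split=> XY t; first by apply/loewner_proj_ortho; rewrite -!spectral_projE.
by rewrite !spectral_projE; apply/loewner_proj_ortho.
Qed.

(** In the coordinates of the diagonalising basis, an eigenvector for a vanishes
    at every index whose diagonal entry differs from a. *)
Lemma eigenspace_sub_rows X a (p : pred 'I_d) : X \is normalmx ->
    (forall i, spectral_diag X 0 i = a -> p i) ->
  (eigenspace X a <= \sum_(i | p i) <<row i (spectralmx X)>>)%MS.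
Proof.
move=> /orthomx_spectralP; set P := spectralmx X; set D := spectral_diag X.
move=> XE pa; apply/row_subP => k; set v := row k _.
have vX : v *m X = a *: v by apply/eigenspaceP; exact: row_sub.
pose w := v *m invmx P.
have wD i : w 0 i * (D 0 i - a) = 0.
  have : w *m diag_mx D = a *: w.
    rewrite /w scalemxAl -vX [in RHS]XE !mulmxA mulmxK //.
    exact: spectral_unit.
  move=> /matrixP /(_ 0 i); rewrite mul_mx_diag !mxE mulrC => /eqP.
  by rewrite -subr_eq0 -mulrBl mulrC => /eqP.
have -> : v = w *m P by rewrite mulmxKV // spectral_unit.
rewrite mulmx_sum_row (bigID p) /= [X in _ + X]big1 ?addr0.
  by apply: summx_sub_sums => i _; rewrite scalemx_sub ?genmxE.
move=> i /negP pi; have /eqP := wD i; rewrite mulf_eq0 => /orP[/eqP->|].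
  by rewrite scale0r.
by rewrite subr_eq0 => /eqP /pa.
Qed.

Lemma row_sub_eigenspace X i : X \is normalmx ->
  (row i (spectralmx X) <= eigenspace X (spectral_diag X 0 i))%MS.
Proof.
move=> /orthomx_spectralP XE; apply/eigenspaceP; rewrite {2}XE !mulmxA -row_mul.
rewrite mulmxV ?spectral_unit // -row_mul mul1mx -row_mul; apply/rowP => j.
by rewrite mul_diag_mx !mxE.
Qed.

Lemma spectral_space_rows X t : X \is normalmx ->
  (spectral_space X t :=: \sum_(i | (t%:C < spectral_diag X 0 i)%R)
                            <<row i (spectralmx X)>>)%MS.
Proof.
move=> nX; rewrite spectral_space.unlock.
apply/eqmxP/andP; split; apply/sumsmx_subP => i ti.
  by apply: eigenspace_sub_rows => // j ->.
by apply: (sumsmx_sup i) => //; rewrite genmxE row_sub_eigenspace.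
Qed.

(** Since the eigenspace of a non-eigenvalue is zero, the index set in the
    definition may be replaced by all scalars above t.  This description no
    longer mentions a diagonalisation, which makes S_X(t) computable for an X
    that is not given in diagonal form. *)
Lemma spectral_space_subP X t (W : 'M_d) : X \is normalmx ->
  reflect (forall a, (t%:C < a)%R -> (eigenspace X a <= W)%MS)
          (spectral_space X t <= W)%MS.
Proof.
move=> nX; apply: (iffP idP) => [XW a ta|XW]; last first.
  by rewrite spectral_space.unlock; apply/sumsmx_subP => i; exact: XW.
apply: submx_trans XW; rewrite spectral_space_rows //.
by apply: eigenspace_sub_rows => // i ->.
Qed.

Lemma sub_spectral_space X t a : X \is normalmx -> (t%:C < a)%R ->
  (eigenspace X a <= spectral_space X t)%MS.
Proof. by move=> nX; apply/spectral_space_subP. Qed.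

(** The basis vectors with eigenvalue > t and the others bound the ranks of two
    subspaces that together span everything, so both bounds are attained. *)
Lemma rank_spectral_space X t : X \is normalmx ->
  \rank (spectral_space X t) = #|[pred i | (t%:C < spectral_diag X 0 i)%R]|.
Proof.
move=> nX; set p := [pred i | _]; rewrite (spectral_space_rows t nX).
pose S (q : pred 'I_d) := (\sum_(i | q i) <<row i (spectralmx X)>>)%MS.
have rS q : (\rank (S q) <= #|q|)%N.
  rewrite -sum1_card (leq_trans (mxrank_sum_leqif _)) //=.
  by apply: leq_sum => i _; rewrite mxrank_gen rank_leq_row.
apply/eqP; rewrite eqn_leq rS /= -(leq_add2r #|predC p|) cardC card_ord.
have full : (1%:M <= S p + S (predC p))%MS.
  apply: submx_trans (_ : (spectralmx X <= _)%MS).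
    by rewrite sub1mx row_full_unit spectral_unit.
  apply/row_subP => i; have [pi|npi] := boolP (p i).
    apply: submx_trans (addsmxSl _ _).
    by apply: (sumsmx_sup i); rewrite ?genmxE.
  apply: submx_trans (addsmxSr _ _).
  by apply: (sumsmx_sup i); rewrite ?genmxE.
have := mxrankS full; rewrite mxrank1 => /leq_trans; apply.
by rewrite (leq_trans (mxrank_adds_leqif _ _)) // leq_add2l.
Qed.

End SpectralSubspace.

(** * Realising a family of subspaces as spectral subspaces *)

Section SpectralFamily.
Context {R : realType} {d : nat}.
Implicit Types (X J W : 'M[R[i]]_d) (t c : R) (a : R[i]).

Lemma spectral_space0P X t : X \is normalmx ->
  reflect (forall a, (t%:C < a)%R -> (eigenspace X a <= (0 : 'M[R[i]]_d))%MS)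
    (spectral_space X t == 0).
Proof. by move=> nX; rewrite -submx0; exact: spectral_space_subP. Qed.

Lemma spectral_space_anti X t t' : t <= t' ->
  (spectral_space X t' <= spectral_space X t)%MS.
Proof.
move=> tt'; rewrite spectral_space.unlock; apply/sumsmx_subP => i t'i.
apply: (sumsmx_sup i) => //.
by apply: le_lt_trans t'i; rewrite lecR.
Qed.

Lemma hermsymmxD X J : X \is hermsymmx -> J \is hermsymmx ->
  X + J \is hermsymmx.
Proof.
by move=> /hermsymmxP Xh /hermsymmxP Jh; apply/hermsymmxP;
  rewrite linearD /= map_mxD Xh Jh.
Qed.

Lemma hermsymmxZ c X : X \is hermsymmx -> c%:C *: X \is hermsymmx.
Proof.
move=> /hermsymmxP Xh; apply/hermsymmxP; rewrite linearZ /= map_mxZ Xh.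
by congr (_ *: _); apply/CrealP; rewrite complex_real.
Qed.

(** The matrix is K = J + (c' - c) P with P the orthogonal projection on W.  As
    J and K commute with P, an eigenvector v of either splits into v P in W,
    whose eigenvalue is c for J and c' for K, and v - v P, which is an
    eigenvector of both matrices for the same eigenvalue.  No eigenvalue of J
    exceeds c, so W is all that K has above c. *)
Lemma raise_top_eigenspace J W c c' : J \is hermsymmx -> c < c' ->
    spectral_space J c = 0 -> (W <= eigenspace J c%:C)%MS ->
  exists2 K, K \is hermsymmx &
    [/\ forall t, t < c -> (spectral_space K t :=: spectral_space J t)%MS,
        forall t, c <= t -> t < c' -> (spectral_space K t :=: W)%MS,
        spectral_space K c' = 0 &
        (W <= eigenspace K c'%:C)%MS].
Proof.
move=> Jh cc' J0 WJ.
have nJ := hermitian_normalmx Jh.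
have := proj_ortho_herm W; have := proj_ortho_proj W.
have PW m (V : 'M_(m, d)) := @proj_ortho_id _ _ _ _ W V.
have subW m (V : 'M_(m, d)) := proj_ortho_sub W V.
move: (proj_ortho W) PW subW => P PW subW /= PP Pherm.
have PJ : P *m J = c%:C *: P.
  apply/eigenspaceP; apply: submx_trans WJ.
  by rewrite -[P]mul1mx.
have JP : J *m P = c%:C *: P.
  rewrite -[LHS]trmxCK trmxC_mul Pherm (elimT (hermsymmxP J) Jh) PJ.
  by rewrite linearZ /= map_mxZ Pherm; congr (_ *: _); apply/CrealP;
    rewrite complex_real.
pose K := J + (c' - c)%:C *: P.
have Kh : K \is hermsymmx.
  exact: hermsymmxD Jh (hermsymmxZ _ (introT (hermsymmxP P) Pherm)).
have nK := hermitian_normalmx Kh.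
have PK : P *m K = c'%:C *: P.
  by rewrite mulmxDr PJ -scalemxAr PP -scalerDl -rmorphD /= subrKC.
have KP : K *m P = c'%:C *: P.
  by rewrite mulmxDl JP -scalemxAl PP -scalerDl -rmorphD /= subrKC.
have WK : (W <= eigenspace K c'%:C)%MS.
  by apply/eigenspaceP; rewrite -[W in LHS]PW // -mulmxA PK -scalemxAr PW.
have KJ (v : 'rV_d) a : v *m K = a *: v ->
    (v - v *m P <= eigenspace J a)%MS /\ (v *m P = 0 \/ a = c'%:C).
  move=> vK.
  have vPK : a *: (v *m P) = c'%:C *: (v *m P).
    by rewrite scalemxAl -vK -mulmxA KP scalemxAr.
  split; last first.
    move/eqP: vPK; rewrite -subr_eq0 -scalerBl scaler_eq0 subr_eq0.
    by case/orP=> /eqP ->; [right | left].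
  apply/eigenspaceP; have -> : J = K - (c' - c)%:C *: P by rewrite addrK.
  rewrite mulmxBr [in X in X - _]mulmxBl vK -[v *m P *m K]mulmxA PK -scalemxAr.
  rewrite -vPK -scalerBr -scalemxAr [(_ - _) *m P]mulmxBl -mulmxA PP subrr.
  by rewrite scaler0 subr0.
have JK (v : 'rV_d) a : v *m J = a *: v -> (v - v *m P <= eigenspace K a)%MS.
  move=> vJ; apply/eigenspaceP.
  have vPJ : a *: (v *m P) = c%:C *: (v *m P).
    by rewrite scalemxAl -vJ -mulmxA JP scalemxAr.
  rewrite mulmxDr -scalemxAr [(_ - _) *m P]mulmxBl -mulmxA PP subrr.
  rewrite scaler0 addr0.
  by rewrite mulmxBl vJ -[v *m P *m J]mulmxA PJ -scalemxAr -vPJ -scalerBr.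
have J0P a (v : 'rV_d) : (c%:C < a)%R -> (v <= eigenspace J a)%MS -> v = 0.
  move=> ca vJ; apply/eqP; rewrite -submx0; apply: submx_trans vJ _.
  by move/eqP: J0 => /(spectral_space0P c nJ)/(_ a ca).
clearbody K; exists K; first exact: Kh.
split; last exact: WK.
- move=> t tc; apply/eqmxP/andP; split.
    apply/(spectral_space_subP _ _ nK) => a ta.
    apply/row_subP => k; have := row_sub k (eigenspace K a).
    move: (row k _) => v /eigenspaceP /KJ [vJ vP].
    rewrite -[v](subrK (v *m P)) addmx_sub //.
      exact: submx_trans vJ (sub_spectral_space nJ ta).
    apply: submx_trans (submx_trans (subW _ v) WJ) (sub_spectral_space nJ _).
    by rewrite ltcR.
  apply/(spectral_space_subP _ _ nJ) => a ta.
  apply/row_subP => k; have := row_sub k (eigenspace J a).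
  move: (row k _) => v /eigenspaceP /JK vJ.
  rewrite -[v](subrK (v *m P)) addmx_sub //.
    exact: submx_trans vJ (sub_spectral_space nK ta).
  apply: submx_trans (submx_trans (subW _ v) WK) (sub_spectral_space nK _).
  by rewrite ltcR (lt_trans tc).
- move=> t ct tc'; apply/eqmxP/andP; split; last first.
    by apply: submx_trans WK (sub_spectral_space nK _); rewrite ltcR.
  apply/(spectral_space_subP _ _ nK) => a ta.
  apply/row_subP => k; have := row_sub k (eigenspace K a).
  move: (row k _) => v /eigenspaceP /KJ [/J0P v0 _].
  rewrite -[v](subrK (v *m P)) v0 ?add0r //.
  by apply: le_lt_trans ta; rewrite lecR.
- apply/eqP/(spectral_space0P _ nK) => a ta.
  apply/row_subP => k; have := row_sub k (eigenspace K a).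
  move: (row k _) => v /eigenspaceP /KJ [/J0P v0 [vP|ac']].
    rewrite -[v](subrK (v *m P)) v0 ?vP ?add0r ?sub0mx //.
    by apply: lt_trans ta; rewrite ltcR.
  by rewrite ac' ltxx in ta.
Qed.

(** The matrix realises V cut off at c: eigenvalues that V would place above c
    are brought down to c.  This is the form that supports an induction on the
    jumps of V below c, listed in decreasing order in s: for the largest of
    them, b, lift V b from the eigenvalue b of the matrix cut off at b to the
    eigenvalue c.  The last clause of the conclusion is what the next lifting
    step requires. *)
Lemma spectral_family_truncated (s : seq R) (V : R -> 'M[R[i]]_d) c :
    sorted >%R s -> all (<%R^~ c) s ->
    (forall t t', t <= t' -> (V t' <= V t)%MS) ->
    (forall t t', t <= t' -> t' < c -> ~~ has (fun x => t < x <= t') s ->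
       (V t' :=: V t)%MS) ->
    (exists t0, forall t, t <= t0 -> (V t :=: 1%:M)%MS) ->
  exists2 J, J \is hermsymmx &
    [/\ forall t, t < c -> (spectral_space J t :=: V t)%MS,
        spectral_space J c = 0 &
        (V c <= eigenspace J c%:C)%MS].
Proof.
move=> + + Vanti + [t0 V1]; elim: s c => [|b s IHs] c.
  move=> _ _ Vconst.
  have Vfull t : t < c -> (V t :=: 1%:M)%MS.
    move=> tc; have [tt0|t0t] := leP t t0; first exact: V1.
    by apply: eqmx_trans (V1 t0 (lexx _)); apply: Vconst => //; exact: ltW.
  pose J : 'M[R[i]]_d := c%:C%:M.
  have Jh : J \is hermsymmx.
    rewrite /J -scalemx1; apply: hermsymmxZ.
    by apply/hermsymmxP; rewrite trmx1 map_mx1.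
  have nJ := hermitian_normalmx Jh.
  have J1 : (1%:M <= eigenspace J c%:C)%MS.
    by apply/eigenspaceP; rewrite mul1mx scalemx1.
  exists J; first exact: Jh.
  split.
  - move=> t tc; apply: eqmx_trans (eqmx_sym (Vfull t tc)).
    apply/eqmxP; rewrite submx1 /=.
    by apply: submx_trans J1 (sub_spectral_space nJ _); rewrite ltcR.
  - apply/eqP/(spectral_space0P _ nJ) => a ca; apply/row_subP => k.
    have := row_sub k (eigenspace J a); move: (row k _) => v /eigenspaceP.
    rewrite mul_mx_scalar => /eqP; rewrite -subr_eq0 -scalerBl scaler_eq0.
    rewrite subr_eq0 lt_eqF //= => /eqP->; exact: sub0mx.
  - by rewrite (submx_trans (submx1 _)).
rewrite /= => sb /andP[bc _] Vconst.
have [|||J Jh [JV J0 VJ]] := IHs b.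
- exact: path_sorted sb.
- by apply: (order_path_min _ sb) => x y z /[swap]; apply: lt_trans.
- move=> t t' tt' t'b Nst; apply: Vconst => //; first exact: lt_trans bc.
  rewrite /= negb_or Nst andbT negb_and -ltNge t'b orbT //.
have [K Kh [KJ KV K0 VK]] := raise_top_eigenspace Jh bc J0 VJ.
exists K; first exact: Kh.
split; [|exact: K0|]; last first.
  by rewrite (submx_trans (Vanti _ _ (ltW bc))).
move=> t tc; have [tb|bt] := ltP t b.
  by apply: eqmx_trans (KJ _ tb) (JV _ tb).
apply: eqmx_trans (KV t bt tc) _; apply/eqmx_sym/Vconst => //.
rewrite /= ltxx /=; apply/hasPn => x xs; rewrite negb_and -leNgt.
have /allP/(_ x xs)/= xb : all (<%R^~ b) s.
  by apply: (order_path_min _ sb) => y z u /[swap]; apply: lt_trans.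
by rewrite (ltW xb).
Qed.

End SpectralFamily.

(** * Multisets of reals determined by counting above thresholds *)

Section CountingAbove.
Context {R : realType}.
Implicit Types (s : seq R) (t x : R).

Lemma seq_bounds s : exists lo hi, all (fun x => lo < x < hi) s.
Proof.
elim: s => [|x s [lo [hi IHs]]]; first by exists 0, 0.
exists (Order.min lo (x - 1)), (Order.max hi (x + 1)).
rewrite /= gt_min lt_max gtrBl ltrDl ltr01 !orbT /=; apply: sub_all IHs => y.
by rewrite gt_min lt_max => /andP[-> ->].
Qed.

(** The heads agree: otherwise, above the smaller head, the list that it heads
    has no element while the other list has its own head. *)
Lemma sorted_count_gt_inj s1 s2 : sorted >=%R s1 -> sorted >=%R s2 ->
    size s1 = size s2 ->
    (forall t, count (fun x => t < x) s1 = count (fun x => t < x) s2) ->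
  s1 = s2.
Proof.
have head_max x s : sorted >=%R (x :: s) ->
    count (fun y => x < y) (x :: s) = 0%N.
  rewrite /= ltxx add0n => xs; apply/eqP; rewrite -leqn0 leqNgt -has_count.
  apply/hasPn => y ys; rewrite -leNgt.
  suff /allP/(_ y ys) : all (>=%R x) s by [].
  by apply: order_path_min xs; exact: ge_trans.
elim: s1 s2 => [|x s1 IHs] [|y s2] // xs ys [ss] cs.
have xy : x = y.
  apply: le_anti; apply/andP; split; rewrite leNgt; apply/negP => lt_xy.
    by have := cs y; rewrite (head_max _ _ ys) /= lt_xy.
  by have := cs x; rewrite (head_max _ _ xs) /= lt_xy.
rewrite xy; congr (_ :: _); apply: IHs => //.
- exact: path_sorted xs.
- exact: path_sorted ys.
by move=> t; have := cs t; rewrite /= xy => /addnI.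
Qed.

Lemma perm_eq_count_gt s1 s2 : size s1 = size s2 ->
    (forall t, count (fun x => t < x) s1 = count (fun x => t < x) s2) ->
  perm_eq s1 s2.
Proof.
move=> ss cs; rewrite -(perm_sort >=%R s1) perm_sym -(perm_sort >=%R s2).
have ge_total : total (>=%R : rel R) by move=> x y; exact: le_total.
suff -> : sort >=%R s1 = sort >=%R s2 by [].
apply: sorted_count_gt_inj; rewrite ?sort_sorted ?size_sort //.
by move=> t; rewrite !count_sort.
Qed.

End CountingAbove.

(** * Eigenvalues, trace and spectral subspaces *)

Section Eigenvalues.
Context {R : realType} {d : nat}.
Implicit Types (X : 'M[R[i]]_d) (t x : R).

(** Taking real parts loses nothing when X is Hermitian; the sequence then lists
    the eigenvalues with multiplicity. *)
Definition eigs X : seq R :=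
  [seq complex.Re (spectral_diag X 0 i) | i <- enum 'I_d].

Lemma size_eigs X : size (eigs X) = d.
Proof. by rewrite size_map size_enum_ord. Qed.

Lemma spectral_diagE X i : X \is hermsymmx ->
  spectral_diag X 0 i = (complex.Re (spectral_diag X 0 i))%:C.
Proof.
by move=> /hermitian_spectral_diag_real/mxOverP/(_ 0 i) Xr; rewrite RRe_real.
Qed.

Lemma mem_eigs X i : complex.Re (spectral_diag X 0 i) \in eigs X.
Proof. by apply: map_f; rewrite mem_enum. Qed.

Lemma count_eigs X t : X \is hermsymmx ->
  count (fun x => t < x) (eigs X) = \rank (spectral_space X t).
Proof.
move=> hX; rewrite rank_spectral_space ?hermitian_normalmx //.
rewrite cardE /eigs count_map enumT -size_filter; congr size.
apply: eq_filter => i /=; rewrite inE /= (spectral_diagE i hX) ltcR //.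
Qed.

Lemma trace_eigs X : X \is hermsymmx -> \tr X = (\sum_(x <- eigs X) x)%:C.
Proof.
move=> hX; have /orthomx_spectralP XE := hermitian_normalmx hX.
rewrite {1}XE -mulmxA mxtrace_mulC -mulmxA mulmxV ?spectral_unit // mulmx1.
rewrite mxtrace_diag big_map big_enum /= rmorph_sum /=.
by apply: eq_bigr => i _; exact: spectral_diagE.
Qed.

Lemma spectral_space_const X t t' : X \is hermsymmx -> t <= t' ->
  ~~ has (fun x => t < x <= t') (eigs X) ->
  spectral_space X t' = spectral_space X t.
Proof.
move=> hX tt' /hasPn Xtt'; rewrite spectral_space.unlock; apply: eq_bigl => i.
rewrite (spectral_diagE i hX) !ltcR; have := Xtt' _ (mem_eigs X i).
case: (ltP t) => [ti|it]; first by rewrite /= -ltNge.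
by move=> _; apply: le_gtF; exact: le_trans it tt'.
Qed.

Lemma spectral_space_eq0 X t : X \is hermsymmx ->
    all (fun x => x <= t) (eigs X) ->
  spectral_space X t = 0.
Proof.
move=> hX /allP Xt; rewrite spectral_space.unlock; apply: big_pred0 => i.
rewrite (spectral_diagE i hX) ltcR.
by apply: le_gtF; exact: Xt (mem_eigs X i).
Qed.

Lemma spectral_space_full X t : X \is hermsymmx ->
  (1%:M <= spectral_space X t)%MS = all (fun x => t < x) (eigs X).
Proof.
by move=> hX; rewrite sub1mx /row_full -count_eigs // all_count size_eigs.
Qed.

Lemma psdmx_eigs_ge0 X : psdmx X -> all (fun x => 0 <= x) (eigs X).
Proof.
move=> [hX Xge0]; apply/allP => _ /mapP[i _ ->].
have nX := hermitian_normalmx hX.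
rewrite /= -lecR -(spectral_diagE i hX); set a := spectral_diag X 0 i.
pose v := row i (spectralmx X).
have vX : v *m X = a *: v by apply/eigenspaceP; exact: row_sub_eigenspace.
have v1 : (v *m v^t*) 0 0 = 1.
  rewrite -dotmxE; have /row_unitarymxP-> := spectral_unitarymx X.
  by rewrite eqxx.
by have := Xge0 (v^t*); rewrite trmxCK vX -scalemxAl mxE v1 mulr1.
Qed.

(** An eigenvector for a > 0 is the image of its multiple by a^-1; conversely X
    kills the basis vectors with eigenvalue 0, and the remaining ones have
    positive eigenvalues. *)
Lemma spectral_space_at0 X : X \is hermsymmx ->
    all (fun x => 0 <= x) (eigs X) ->
  (spectral_space X 0 :=: X)%MS.
Proof.
move=> hX /allP Xge0; have nX := hermitian_normalmx hX.
apply/eqmxP/andP; split.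
  apply/(spectral_space_subP _ _ nX) => a a_gt0.
  have /eigenspaceP aX := submx_refl (eigenspace X a).
  by rewrite -(eqmx_scale (eigenspace X a) (lt0r_neq0 a_gt0)) -aX submxMl.
have /orthomx_spectralP XE := nX.
rewrite {1}XE -mulmxA; apply: submx_trans (submxMl _ _) _.
apply/row_subP => i.
have -> : row i (diag_mx (spectral_diag X) *m spectralmx X) =
    spectral_diag X 0 i *: row i (spectralmx X).
  by apply/rowP => j; rewrite mul_diag_mx !mxE.
have := Xge0 _ (mem_eigs X i); rewrite le_eqVlt => /predU1P[i0|i_gt0].
  by rewrite (spectral_diagE i hX) -i0 scale0r sub0mx.
apply: scalemx_sub; apply: submx_trans (row_sub_eigenspace _ nX) _.
by apply: sub_spectral_space nX _; rewrite (spectral_diagE i hX) ltcR.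
Qed.

Lemma trace_eq0 X : X \is hermsymmx -> all (fun x => 0 <= x) (eigs X) ->
  \tr X = 0 <-> X = 0.
Proof.
move=> hX Xge0; split=> [|->]; last by rewrite mxtrace0.
rewrite trace_eigs // => /(@complexI R _ 0) /eqP.
rewrite big_seq psumr_eq0 => [/allP X0|x]; last exact: (allP Xge0).
suff S0 : spectral_space X 0 = 0.
  by apply/eqP; rewrite -submx0 -(spectral_space_at0 hX Xge0) S0.
apply: spectral_space_eq0 => //; apply/allP => x xX.
by have := X0 x xX; rewrite xX => /eqP ->.
Qed.

(** Cut off at a level above all jumps, where the cut-off changes nothing. *)
Lemma spectral_family (s : seq R) (V : R -> 'M[R[i]]_d) :
    (forall t t', t <= t' -> (V t' <= V t)%MS) ->
    (forall t t', t <= t' -> ~~ has (fun x => t < x <= t') s ->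
       (V t' :=: V t)%MS) ->
    (forall t, all (fun x => t < x) s -> (1%:M <= V t)%MS) ->
    (forall t, all (fun x => x <= t) s -> V t = 0) ->
  exists2 J, J \is hermsymmx & forall t, (spectral_space J t :=: V t)%MS.
Proof.
move=> Vanti Vconst V1 V0; have [lo [hi /allP s_lohi]] := seq_bounds s.
pose r := rev (sort <=%R (undup s)).
have r_s : r =i s by move=> x; rewrite mem_rev mem_sort mem_undup.
have r_sorted : sorted >%R r.
  by rewrite rev_sorted sort_lt_sorted undup_uniq.
have r_hi : all (fun x => x < hi) r.
  by apply/allP => x; rewrite r_s => /s_lohi/andP[].
have [||J hJ [JV J0 _]] := spectral_family_truncated r_sorted r_hi Vanti.
- by move=> t t' tt' _; rewrite (eq_has_r r_s); exact: Vconst.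
- exists lo => t tlo; apply/eqmxP; rewrite submx1 V1 //.
  by apply/allP => x /s_lohi/andP[lox _]; exact: le_lt_trans lox.
exists J => // t; have [/JV//|hit] := ltP t hi.
have -> : spectral_space J t = 0.
  by apply/eqP; rewrite -submx0 -J0 spectral_space_anti.
suff -> : V t = 0 by [].
by apply: V0; apply/allP => x /s_lohi/andP[_ /ltW xhi]; exact: le_trans hit.
Qed.

End Eigenvalues.

(** * Join and meet for the spectral order *)

Section JoinMeet.
Context {R : realType} {d : nat}.
Implicit Types (A B J M : 'M[R[i]]_d) (t : R).

Lemma spectral_space_join_exists A B : A \is hermsymmx -> B \is hermsymmx ->
  exists2 J, J \is hermsymmx &
    forall t, (spectral_space J t :=:
                 spectral_space A t + spectral_space B t)%MS.
Proof.
move=> hA hB.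
apply: (@spectral_family _ _ (eigs A ++ eigs B)
  (fun t => (spectral_space A t + spectral_space B t)%MS))
  => [t t' tt'|t t' tt'|t|t].
- by apply: addsmxS; exact: spectral_space_anti.
- rewrite has_cat negb_or => /andP[nA nB].
  by rewrite !(spectral_space_const _ tt').
- rewrite all_cat => /andP[At _]; apply: submx_trans (addsmxSl _ _).
  by rewrite spectral_space_full.
- rewrite all_cat => /andP[At Bt]; rewrite !spectral_space_eq0 //.
  by apply/eqP; rewrite -submx0 addsmx_sub !sub0mx.
Qed.

Lemma spectral_space_meet_exists A B : A \is hermsymmx -> B \is hermsymmx ->
  exists2 M, M \is hermsymmx &
    forall t, (spectral_space M t :=:
                 spectral_space A t :&: spectral_space B t)%MS.
Proof.
move=> hA hB.
apply: (@spectral_family _ _ (eigs A ++ eigs B)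
  (fun t => (spectral_space A t :&: spectral_space B t)%MS))
  => [t t' tt'|t t' tt'|t|t].
- by apply: capmxS; exact: spectral_space_anti.
- rewrite has_cat negb_or => /andP[nA nB].
  by rewrite !(spectral_space_const _ tt').
- rewrite all_cat => /andP[At Bt]; rewrite sub_capmx; apply/andP.
  by split; rewrite spectral_space_full.
- rewrite all_cat => /andP[At Bt]; rewrite !spectral_space_eq0 //.
  by apply/eqP; rewrite -submx0 capmxSl.
Qed.

(** The realised matrix K is a join, so the chosen join exists and lies both
    above and below K, which forces the same spectral subspaces. *)
Lemma spectral_joinP A B : A \is hermsymmx -> B \is hermsymmx ->
  spectral_join A B \is hermsymmx /\
  forall t, (spectral_space (spectral_join A B) t :=:
               spectral_space A t + spectral_space B t)%MS.
Proof.
move=> hA hB; have [K hK KE] := spectral_space_join_exists hA hB.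
have AK : spectral_le A K by apply/spectral_leP => t; rewrite KE addsmxSl.
have BK : spectral_le B K by apply/spectral_leP => t; rewrite KE addsmxSr.
have Kleast L : spectral_le A L -> spectral_le B L -> spectral_le K L.
  move=> /spectral_leP AL /spectral_leP BL; apply/spectral_leP => t.
  by rewrite KE addsmx_sub; apply/andP; split; [exact: AL | exact: BL].
have : is_spectral_join A B (spectral_join A B).
  by apply: (xgetI 0); exact: And4 hK AK BK (fun L _ => Kleast L).
case=> hJ AJ BJ Jleast; split=> [|t]; first exact: hJ.
apply/eqmxP/andP; split.
  by rewrite -KE; move: t; apply/spectral_leP/Jleast.
by rewrite addsmx_sub; apply/andP; split; move: t; exact/spectral_leP.
Qed.

Lemma spectral_meetP A B : A \is hermsymmx -> B \is hermsymmx ->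
  spectral_meet A B \is hermsymmx /\
  forall t, (spectral_space (spectral_meet A B) t :=:
               spectral_space A t :&: spectral_space B t)%MS.
Proof.
move=> hA hB; have [K hK KE] := spectral_space_meet_exists hA hB.
have KA : spectral_le K A by apply/spectral_leP => t; rewrite KE capmxSl.
have KB : spectral_le K B by apply/spectral_leP => t; rewrite KE capmxSr.
have Kgreatest L : spectral_le L A -> spectral_le L B -> spectral_le L K.
  move=> /spectral_leP LA /spectral_leP LB; apply/spectral_leP => t.
  by rewrite KE sub_capmx; apply/andP; split; [exact: LA | exact: LB].
have : is_spectral_meet A B (spectral_meet A B).
  by apply: (xgetI 0); exact: And4 hK KA KB (fun L _ => Kgreatest L).
case=> hM MA MB Mgreatest; split=> [|t]; first exact: hM.
apply/eqmxP/andP; split.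
  by rewrite sub_capmx; apply/andP; split; move: t; exact/spectral_leP.
by rewrite -KE; move: t; apply/spectral_leP/Mgreatest.
Qed.

Lemma trace_join_meet A B : A \is hermsymmx -> B \is hermsymmx ->
  \tr (spectral_join A B) + \tr (spectral_meet A B) = \tr A + \tr B.
Proof.
move=> hA hB; have [] := spectral_meetP hA hB; have [] := spectral_joinP hA hB.
move: (spectral_join A B) (spectral_meet A B) => J M hJ JE hM ME.
rewrite !trace_eigs // -!rmorphD /= -!big_cat /=; congr (_%:C).
apply: perm_big; apply: perm_eq_count_gt; first by rewrite !size_cat !size_eigs.
by move=> t; rewrite !count_cat !count_eigs // JE ME mxrank_sum_cap.
Qed.

(** A negative eigenvalue x of the meet would violate fullness of its spectral
    subspace at x, which is inherited from A and B. *)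
Lemma spectral_meet_eigs_ge0 A B : psdmx A -> psdmx B ->
  all (fun x => 0 <= x) (eigs (spectral_meet A B)).
Proof.
move=> pA pB; have [hA _] := pA; have [hB _] := pB.
have [hM ME] := spectral_meetP hA hB.
apply/allP => x xM; rewrite leNgt; apply/negP => x_lt0.
suff /allP/(_ x xM) : all (fun y => x < y) (eigs (spectral_meet A B)).
  by rewrite ltxx.
rewrite -spectral_space_full // ME sub_capmx !spectral_space_full //.
by apply/andP; split; [move: (psdmx_eigs_ge0 pA) | move: (psdmx_eigs_ge0 pB)];
  apply: sub_all => y; exact: lt_le_trans.
Qed.

(** Taking adjoints exchanges the column range of a Hermitian matrix with its
    row space. *)
Lemma mxran_cap_eq0 A B : A \is hermsymmx -> B \is hermsymmx ->
  mxran A `&` mxran B = [set 0] <-> (A :&: B)%MS = 0.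
Proof.
move=> /hermsymmxP hA /hermsymmxP hB; split=> AB.
  apply/eqP; rewrite -submx0; apply/row_subP => k.
  have := row_sub k (A :&: B)%MS.
  move: (row k _) => u; rewrite sub_capmx => /andP[/submxP[x uA] /submxP[y uB]].
  suff : (mxran A `&` mxran B) (u^t*).
    by rewrite AB /= => u0; rewrite -[u]trmxCK u0 trmx0 map_mx0 sub0mx.
  split; first by exists (x^t*) => //; rewrite uA trmxC_mul hA.
  by exists (y^t*) => //; rewrite uB trmxC_mul hB.
apply/seteqP; split=> [z [[x _ zA] [y _ zB]]|_ ->]; last first.
  by split; exists 0 => //; rewrite mulmx0.
suff : (z^t* <= (A :&: B))%MS.
  by rewrite AB submx0 => /eqP z0; rewrite /= -[z]trmxCK z0 trmx0 map_mx0.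
rewrite sub_capmx; apply/andP; split.
  by rewrite -zA trmxC_mul hA submxMl.
by rewrite -zB trmxC_mul hB submxMl.
Qed.

End JoinMeet.

Theorem corollary2p2 (R : realType) (d : nat) (A B : 'M[R[i]]_d)
    (hA : psdmx A) (hB : psdmx B) :
  [/\ \tr (A + B) - \tr (spectral_join A B) = \tr (spectral_meet A B),
      \tr (spectral_join A B) = \tr (A + B) <-> spectral_meet A B = 0 &
      spectral_meet A B = 0 <-> mxran A `&` mxran B = [set 0]].
Proof.
have [hermA _] := hA; have [hermB _] := hB.
have [hM ME] := spectral_meetP hermA hermB.
have M_ge0 := spectral_meet_eigs_ge0 hA hB.
have trAB : \tr (A + B) - \tr (spectral_join A B) = \tr (spectral_meet A B).
  by rewrite mxtraceD -trace_join_meet // addrC addKr.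
move: (spectral_join A B) (spectral_meet A B) hM ME M_ge0 trAB.
move=> J M hM ME M_ge0 trAB.
have trM0 := trace_eq0 hM M_ge0.
have MAB : (M :=: A :&: B)%MS.
  apply: eqmx_trans (eqmx_sym (spectral_space_at0 hM M_ge0)) _.
  apply: eqmx_trans (ME 0) _; apply: cap_eqmx.
    exact: spectral_space_at0 (psdmx_eigs_ge0 hA).
  exact: spectral_space_at0 (psdmx_eigs_ge0 hB).
have ranAB := mxran_cap_eq0 hermA hermB.
split; first exact: trAB.
  split=> [trJ|/trM0]; first by apply/trM0; rewrite -trAB trJ subrr.
  by rewrite -trAB => /eqP; rewrite subr_eq0 => /eqP.
split=> [M0|/ranAB AB0]; first apply/ranAB; apply/eqP; rewrite -submx0.
  by rewrite -MAB M0.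
by rewrite MAB AB0.
Qed.
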